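(* Let $0 < \alpha < 1$, and consider the system of differential equations in the context for the asymptotic model of Robin Hood hashing with alternating deletions and insertions (without tombstones) at load $\alpha$. Let $(s_i)_{i \ge 1}$ be the equilibrium point of this system, i.e. the values at which $ds_i/dt = 0$ for every $i \ge 1$. Then there exist constants $c_1 > 0$, $c_3 > 0$ and $0 < c_2 < 1$, which may depend on $\alpha$, such that for all sufficiently large integers $i$, $$s_i \le c_1\, c_2^{\,2^{\,i-c_3}}.$$
   Context: Model: a Robin Hood hash table (collisions resolved in favor of the key with larger age, where a key making its $j$-th probe has age $j$) is filled to load $\alpha$, and then one alternately deletes a uniformly random key (the cell simply becomes empty, no tombstone) and inserts a fresh key. In the asymptotic model, $s_i$ denotes the fraction of cells holding a key of age at least $i$ (with $s_1=\alpha$ throughout), $p_i$ denotes the (equilibrium) probability that the key currently being placed has age at least $i$, and $q$ the probability that the current step is a deletion. These satisfy $q = \frac{1-\alpha}{2-\alpha}$, $p_1 = \frac{1}{2-\alpha}$, $p_i = p_{i-1}s_{i-1}$ for $i \ge 2$, and the limiting differential equations are $$\frac{ds_i}{dt} = p_i(1-\alpha) - q\,\frac{s_i}{\alpha}, \quad i \ge 1.$$ *)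

(* Defs.v *)
From Stdlib Require Import Reals.
Open Scope R_scope.

(* Sequences are indexed by i >= 1 as functions on [nat]; the value at index 0
   carries no meaning and is never constrained or used. *)

Definition deletion_prob (alpha : R) : R := (1 - alpha) / (2 - alpha).

(* p_1 = 1/(2 - alpha) and p_i = p_{i-1} s_{i-1} for i >= 2: the probability
   that the key currently being placed has age at least i. *)
Fixpoint place_prob (alpha : R) (s : nat -> R) (i : nat) : R :=
  match i with
  | O => 0
  | S O => 1 / (2 - alpha)
  | S (S _ as j) => place_prob alpha s j * s j
  end.

(* Right-hand side of the differential equation for ds_i/dt. *)
Definition drift (alpha : R) (s : nat -> R) (i : nat) : R :=
  place_prob alpha s i * (1 - alpha) - deletion_prob alpha * (s i / alpha).

Definition is_equilibrium (alpha : R) (s : nat -> R) : Prop :=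
  s 1%nat = alpha /\ forall i : nat, (1 <= i)%nat -> drift alpha s i = 0.

(* Main.v *)
(** At an equilibrium [s_i = alpha (2 - alpha) p_i], so [p_(i+1) = p_i s_i]
    becomes [s_(i+1) = s_i ^ 2].  Since [s_1 = alpha], the equilibrium is
    exactly [s_i = alpha ^ (2 ^ (i - 1))], and the bound holds with equality
    for [c_1 = 1], [c_2 = alpha], [c_3 = 1]. *)

Require Import Defs.
From Stdlib Require Import Reals.
From Stdlib Require Import Lra Lia.
Open Scope R_scope.

Lemma drift_eq0 (alpha : R) (s : nat -> R) (i : nat) :
  0 < alpha < 1 -> drift alpha s i = 0 ->
  s i = alpha * (2 - alpha) * place_prob alpha s i.
Proof.
  unfold drift, deletion_prob; intros Ha Hd.
  (* The factor is [deletion_prob alpha / alpha], the rate at which [s i] enters the drift; it turns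
     the difference of the two sides into minus the drift. *)
  apply Rminus_diag_uniq, Rmult_eq_reg_l with ((1 - alpha) / (2 - alpha) / alpha).
  - rewrite Rmult_0_r, <- Ropp_0, <- Hd; field; lra.
  - apply Rgt_not_eq; repeat apply Rdiv_lt_0_compat; lra.
Qed.

Lemma equilibrium_succ (alpha : R) (s : nat -> R) (j : nat) :
  0 < alpha < 1 -> is_equilibrium alpha s -> s (S (S j)) = s (S j) * s (S j).
Proof.
  intros Ha [_ Hd].
  rewrite (drift_eq0 alpha s (S (S j)) Ha (Hd (S (S j)) ltac:(lia))).
  change (place_prob alpha s (S (S j))) with (place_prob alpha s (S j) * s (S j)).
  (* The equilibrium relation, read backwards at [S j], absorbs the constant
     [alpha * (2 - alpha)]. *)
  rewrite <- Rmult_assoc, <- drift_eq0; auto with arith.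
Qed.

Lemma equilibrium_closed_form (alpha : R) (s : nat -> R) (j : nat) :
  0 < alpha < 1 -> is_equilibrium alpha s ->
  s (S j) = Rpower alpha (Rpower 2 (INR j)).
Proof.
  intros Ha Heq; induction j as [|j IH].
  - destruct Heq as [H1 _]; simpl INR; rewrite H1, Rpower_O, Rpower_1; lra.
  - rewrite (equilibrium_succ alpha s j Ha Heq), IH, <- Rpower_plus.
    (* Squaring doubles the exponent: [2^j + 2^j = 2^(j+1)]. *)
    f_equal; rewrite S_INR, Rpower_plus, Rpower_1; lra.
Qed.

Theorem theorem6 (alpha : R) (halpha : 0 < alpha < 1) :
  exists c1 c2 c3 : R,
    0 < c1 /\ 0 < c2 < 1 /\ 0 < c3 /\
    forall s : nat -> R, is_equilibrium alpha s ->
      exists N : nat, forall i : nat, (N <= i)%nat ->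
        s i <= c1 * Rpower c2 (Rpower 2 (INR i - c3)).
Proof.
  exists 1, alpha, 1; repeat split; try lra.
  (* [N = 1] only excludes the meaningless index 0. *)
  intros s Heq; exists 1%nat; intros [|j] Hi; [lia|].
  rewrite (equilibrium_closed_form alpha s j halpha Heq), S_INR.
  replace (INR j + 1 - 1) with (INR j) by ring; lra.
Qed.
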